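(* There is a polynomial-time algorithm that solves CFFA on instances in which every vertex of the conflict graph $\mathcal{H}$ has degree $m-2$ (where $m=|\mathcal{I}|$) and the utility functions are uniform, i.e., $u_a=u_{a'}$ for all agents $a,a'$.
   Context: CFFA: the input is a finite set of agents $\mathcal{A}$, a finite set of jobs $\mathcal{I}$, for each agent $a\in\mathcal{A}$ a utility function $u_a\colon\mathcal{I}\to\mathbb{N}$, a positive integer $\eta$, and a graph $\mathcal{H}$ with vertex set $\mathcal{I}$. The question is whether there is $\phi\colon\mathcal{A}\to 2^{\mathcal{I}}$ such that each $\phi(a)$ is an independent set in $\mathcal{H}$ with $\sum_{x\in\phi(a)}u_a(x)\ge\eta$, and the sets $\phi(a)$, $a\in\mathcal{A}$, are pairwise disjoint. *)

(* Defs.v *)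
From HB Require Import structures.
From mathcomp Require Import all_boot all_order all_algebra.
Set Implicit Arguments.
Unset Strict Implicit.
Unset Printing Implicit Defensive.

Inductive direction := Left | Stay | Right.

(* A two-way infinite tape: the cells to the left of the head (nearest first),
   the scanned cell, and the cells to its right; every cell beyond the two
   lists is blank, and the blank symbol is [None]. *)
Record tape (G : Type) := Tape {
  left_cells : seq (option G);
  scanned : option G;
  right_cells : seq (option G) }.

Definition blank_tape (G : Type) : tape G := Tape [::] None [::].

Definition tape_of_seq (G : Type) (w : seq G) : tape G :=
  Tape [::] (ohead w) (map Some (behead w)).

Definition write (G : Type) (a : option G) (t : tape G) : tape G :=
  Tape (left_cells t) a (right_cells t).

Definition move (G : Type) (d : direction) (t : tape G) : tape G :=
  let: Tape l a r := t in
  match d with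
  | Left => Tape (behead l) (head None l) (a :: r)
  | Stay => t
  | Right => Tape (a :: l) (head None r) (behead r)
  end.

(* [S] is the input alphabet and [S + aux] the tape alphabet, blank excluded.
   Tape [ord0] is the input tape, which is also writable. A state [q] with
   [verdict q = Some b] is halting, with answer [b]. All the types involved are
   finite, so the transition function is a finite table. *)
Record machine (S : finType) := Machine {
  work_tapes : nat;
  aux : finType;
  state : finType;
  start : state;
  verdict : state -> option bool;
  delta : state -> {ffun 'I_work_tapes.+1 -> option (S + aux)} ->
          state * {ffun 'I_work_tapes.+1 -> option (S + aux) * direction} }.

Section Run.
Variables (S : finType) (M : machine S).

Definition config : Type :=
  (state M * {ffun 'I_(work_tapes M).+1 -> tape (S + aux M)})%type.

Definition init (w : seq S) : config :=
  (start M, [ffun i => if i == ord0 then tape_of_seq (map inl w)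
                       else blank_tape (S + aux M)]).

Definition step (c : config) : config :=
  if verdict c.1 is Some _ then c
  else let: (q, act) := delta c.1 [ffun i => scanned (c.2 i)] in
       (q, [ffun i => move (act i).2 (write (act i).1 (c.2 i))]).

(* Halting configurations are fixed by [step], hence "within [t] steps". *)
Definition answers_within (w : seq S) (t : nat) (b : bool) : Prop :=
  verdict (iter t step (init w)).1 = Some b.

End Run.

(* Decision of a problem whose instances [x : X] are promised to satisfy [P];
   nothing is required of [M] on words that do not encode such an instance. *)
Definition decides_in_polytime (S : finType) (M : machine S)
    (X : Type) (encode : X -> seq S) (P yes : X -> Prop) : Prop :=
  exists p : {poly nat}, forall x : X, P x ->
    exists b : bool,
      answers_within M (encode x) p.[size (encode x)]%R b /\ (b <-> yes x).

Record cffa := Cffa {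
  agents : finType;
  jobs : finType;
  utility : agents -> jobs -> nat;
  target : nat;
  conflict : rel jobs;
  target_gt0 : 0 < target;
  conflict_sym : symmetric conflict;
  conflict_irr : irreflexive conflict }.

Definition independent (T : finType) (e : rel T) (A : {set T}) : Prop :=
  forall x y : T, x \in A -> y \in A -> ~~ e x y.

Definition degree (T : finType) (e : rel T) (x : T) : nat := #|[set y | e x y]|.

Definition feasible (I : cffa) : Prop :=
  exists phi : agents I -> {set jobs I},
    [/\ forall a, independent (@conflict I) (phi a),
        forall a, target I <= \sum_(x in phi a) utility a x &
        forall a a', a != a' -> [disjoint phi a & phi a']].

Definition uniform (I : cffa) : Prop :=
  forall (a a' : agents I) (x : jobs I), utility a x = utility a' x.

(* Additive form of [degree = m - 2]: truncated subtraction would wrongly let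
   in the instances with a single job. *)
Definition regular_m_minus_2 (I : cffa) : Prop :=
  forall x : jobs I, degree (@conflict I) x + 2 = #|jobs I|.

Inductive symbol := Bit of bool | EndNumber | EndRow | EndSection.

Definition symbol_code (s : symbol) : bool + 'I_3 :=
  match s with
  | Bit b => inl b
  | EndNumber => inr (inord 0)
  | EndRow => inr (inord 1)
  | EndSection => inr (inord 2)
  end.

Definition symbol_decode (c : bool + 'I_3) : symbol :=
  match c with
  | inl b => Bit b
  | inr i => nth EndSection [:: EndNumber; EndRow] i
  end.

Lemma symbol_codeK : cancel symbol_code symbol_decode.
Proof. by case=> //=; rewrite inordK. Qed.

HB.instance Definition _ := Finite.copy symbol (can_type symbol_codeK).

(* Binary, least significant bit first, without superfluous leading zeros
   ([0] is written with the single digit 0). *)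
Definition binary (n : nat) : seq symbol :=
  mkseq (fun i => Bit (odd (n %/ 2 ^ i))) (trunc_log 2 n).+1.

(* The target, the table of utilities (one row per agent) and the adjacency
   matrix, agents and jobs being listed in the order of [enum]. *)
Definition encode_cffa (I : cffa) : seq symbol :=
  binary (target I) ++ EndSection ::
  flatten [seq rcons (flatten [seq rcons (binary (utility a x)) EndNumber
                              | x <- enum (jobs I)]) EndRow
          | a <- enum (agents I)] ++ EndSection ::
  flatten [seq rcons [seq Bit (conflict x y) | y <- enum (jobs I)] EndRow
          | x <- enum (jobs I)].

(* Main.v *)
Require Import Defs.
From HB Require Import structures.
From mathcomp Require Import all_boot all_order all_algebra zify.

(* When all degrees are m - 2, the complement of the conflict graph is a perfect
   matching: an independent set is contained in a pair of non-adjacent jobs. With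
   uniform utilities such a pair serves two agents if each of its jobs reaches
   the target, otherwise one agent if their sum does, otherwise none; hence an
   instance is feasible iff the capacities of the pairs add up to at least the
   number n of agents. Each pair is given by the two zeros of two rows of the
   adjacency matrix, so that the condition reads 2n <= sum over the rows of the
   capacities. The machine evaluates this sum row by row, in linear time per row:
   the addition and the comparisons are done digit by digit on three parallel
   heads. *)

Set Implicit Arguments.
Unset Strict Implicit.
Unset Printing Implicit Defensive.

(** * The machine *)

(** The arguments of [Compare] are the carry and the outcomes for the sum, the first and the second
    job. In [RowEnd] and [Rewind] they tell whether the sum, and whether each job alone, reaches the
    target. A head moves one cell per step, so a second unit of capacity needs its own phase
    [Charge]. *)
Inductive phase :=
  | Init | CopyTarget | CopyRow | Mark | Skim
  | First | SkipBoth | Second | SkipOne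
  | Compare of bool & bool & bool & bool
  | RowEnd of bool & bool | Rewind of bool & bool | Charge of bool
  | Final | Accept | Reject.

Definition phase_code (q : phase) : 'I_16 * (bool * bool * bool * bool) :=
  let z := (false, false, false, false) in
  match q with
  | Init => (inord 0, z)
  | CopyTarget => (inord 1, z)
  | CopyRow => (inord 2, z)
  | Mark => (inord 3, z)
  | Skim => (inord 4, z)
  | First => (inord 5, z)
  | SkipBoth => (inord 6, z)
  | Second => (inord 7, z)
  | SkipOne => (inord 8, z)
  | Compare a b c d => (inord 9, (a, b, c, d))
  | RowEnd a b => (inord 10, (a, b, false, false))
  | Rewind a b => (inord 11, (a, b, false, false))
  | Charge a => (inord 12, (a, false, false, false))
  | Final => (inord 13, z)
  | Accept => (inord 14, z)
  | Reject => (inord 15, z)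
  end.

Definition phase_decode (x : 'I_16 * (bool * bool * bool * bool)) : phase :=
  let: (i, (a, b, c, d)) := x in
  nth Init [:: Init; CopyTarget; CopyRow; Mark; Skim; First; SkipBoth; Second;
    SkipOne; Compare a b c d; RowEnd a b; Rewind a b; Charge a; Final; Accept;
    Reject] i.

Lemma phase_codeK : cancel phase_code phase_decode.
Proof. by case=> * /=; rewrite inordK. Qed.

HB.instance Definition _ := Finite.copy phase (can_type phase_codeK).

Notation cell := (option (symbol + void)).

Definition sym (s : symbol) : cell := Some (inl s).

Definition is_bit (x : cell) : bool := if x is Some (inl (Bit _)) then true else false.

Definition bit_of (x : cell) : bool := if x is Some (inl (Bit b)) then b else false.

(* The digits are read least significant first, so that a digit in which the
   two numbers differ overrides the outcome [g] of the previous ones. *)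
Definition ge_update (g s z : bool) : bool := if s == z then g else s.

Definition majority (x y z : bool) : bool := [|| x && y, x && z | y && z].

(* [t], [u], [v] and [c] scan the tapes that hold the target, two copies of the
   utility row, and the counter. The counter receives two marks per agent, and
   each row of the adjacency matrix moves its head left by the capacity of the
   row: there are enough jobs iff the head has left the marks at the end. The
   heads of the utility tapes follow the scan of a matrix row and stop at its
   first and at its second zero, respectively. *)
Definition transition (q : phase) (i t u v c : cell) :
    phase * ((cell * direction) * (cell * direction) * (cell * direction) *
             (cell * direction) * (cell * direction)) :=
  let N x := (x, Stay) in
  let R x := (x, Right) in
  let L x := (x, Left) in
  let advance x := if is_bit x then R x else N x in
  let back x := if isSome x then L x else N x in
  let mark := R (sym EndRow) in
  match q with
  | Init => (CopyTarget, (N i, R t, R u, R v, N c))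
  | CopyTarget =>
      match i with
      | Some (inl EndSection) => (CopyRow, (R i, N i, N u, N v, N c))
      | _ => (CopyTarget, (R i, R i, N u, N v, N c))
      end
  | CopyRow =>
      match i with
      | Some (inl EndRow) => (Mark, (N i, N t, N i, N i, mark))
      | Some (inl EndSection) => (Accept, (N i, N t, N u, N v, N c))
      | _ => (CopyRow, (R i, N t, R i, R i, N c))
      end
  | Mark => (Skim, (R i, N t, N u, N v, mark))
  | Skim =>
      match i with
      | Some (inl EndRow) => (Mark, (N i, N t, N u, N v, mark))
      | Some (inl EndSection) => (Rewind false false, (R i, N t, N u, N v, N c))
      | _ => (Skim, (R i, N t, N u, N v, N c))
      end
  | First =>
      match i with
      | Some (inl (Bit true)) => (SkipBoth, (R i, N t, N u, N v, N c))
      | Some (inl (Bit false)) => (SkipOne, (R i, N t, N u, N v, N c))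
      | _ => (Final, (N i, N t, N u, N v, L c))
      end
  | SkipBoth =>
      (if u is Some (inl EndNumber) then First else SkipBoth,
       (N i, N t, R u, R v, N c))
  | Second =>
      match i with
      | Some (inl (Bit true)) => (SkipOne, (R i, N t, N u, N v, N c))
      | _ => (Compare false true true true, (R i, N t, N u, N v, N c))
      end
  | SkipOne =>
      (if v is Some (inl EndNumber) then Second else SkipOne,
       (N i, N t, N u, R v, N c))
  | Compare k g g1 g2 =>
      if [|| is_bit t, is_bit u | is_bit v] then
        let x := bit_of u in let y := bit_of v in let z := bit_of t in
        (Compare (majority x y k) (ge_update g (x (+) y (+) k) z)
                 (ge_update g1 x z) (ge_update g2 y z),
         (N i, advance t, advance u, advance v, N c))
      else (RowEnd (k || g) (g1 && g2), (N i, N t, N u, N v, N c))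
  | RowEnd a b =>
      (if i is Some (inl EndRow) then Rewind a b else RowEnd a b,
       (R i, N t, N u, N v, N c))
  | Rewind a b =>
      if [|| isSome t, isSome u | isSome v] then
        (Rewind a b, (N i, back t, back u, back v, N c))
      else (Charge b, (N i, R t, R u, R v, if a then L c else N c))
  | Charge b => (First, (N i, N t, N u, N v, if b then L c else N c))
  | Final => (if isSome c then Reject else Accept, (N i, N t, N u, N v, N c))
  | Accept | Reject => (q, (N i, N t, N u, N v, N c))
  end.

Definition phase_verdict (q : phase) : option bool :=
  match q with Accept => Some true | Reject => Some false | _ => None end.

Definition matching_machine : machine symbol :=
  @Machine symbol 4 void phase Init phase_verdict
    (fun q f =>
       let: (q', (a, b, c, d, e)) :=
         transition q (f (inord 0)) (f (inord 1)) (f (inord 2)) (f (inord 3))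
                    (f (inord 4)) in
       (q', [ffun i : 'I_5 => nth a [:: a; b; c; d; e] i])).

(** * The machine on five named tapes *)

Notation stape := (tape (symbol + void)).

(* Naming the five tapes, instead of indexing them by ['I_5], lets [pstep]
   below reduce by computation. *)
Record pconf := PConf {
  pphase : phase; input : stape; goal : stape; fst_row : stape; snd_row : stape;
  counter : stape }.

Definition conf_of (p : pconf) : config matching_machine :=
  (pphase p : state matching_machine,
   [ffun i : 'I_5 => nth (input p)
      [:: input p; goal p; fst_row p; snd_row p; counter p] i]).

Definition act (x : cell * direction) (t : stape) : stape := move x.2 (write x.1 t).

Definition pstep (p : pconf) : pconf :=
  let: PConf q i t u v c := p in
  if phase_verdict q is Some _ then p else
  let: (q', (a, b, d, e, f)) :=
    transition q (scanned i) (scanned t) (scanned u) (scanned v) (scanned c) in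
  PConf q' (act a i) (act b t) (act d u) (act e v) (act f c).

Lemma step_conf_of p : step (conf_of p) = conf_of (pstep p).
Proof.
case: p => q i t u v c; rewrite /step /pstep /=.
case: (phase_verdict q) => [b|] //=.
rewrite !ffunE /= !inordK //=.
case: transition => q' [[[[a b] d] e] f].
congr (_, _); apply/ffunP; case=> k lt_k5; rewrite !ffunE /=.
by case: k lt_k5 => [|[|[|[|[|k]]]]].
Qed.

Lemma iter_step_conf_of k p : iter k (@step _ _) (conf_of p) = conf_of (iter k pstep p).
Proof. by elim: k => //= k ->; rewrite step_conf_of. Qed.

(** * Runs in a bounded number of steps *)

Definition reach (k : nat) (p p' : pconf) : Prop :=
  exists2 j, j <= k & iter j pstep p = p'.

Lemma reach_refl k p : reach k p p.
Proof. by exists 0. Qed.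

Lemma reach_trans j k p q r : reach j p q -> reach k q r -> reach (j + k) p r.
Proof.
move=> [a le_a <-] [b le_b <-]; exists (b + a); last by rewrite iterD.
by rewrite addnC leq_add.
Qed.

Lemma reach_leq j k p q : j <= k -> reach j p q -> reach k p q.
Proof. by move=> le_jk [a le_a <-]; exists a => //; apply: leq_trans le_jk. Qed.

Lemma reach_step k p q : reach k (pstep p) q -> reach k.+1 p q.
Proof. by move=> [a le_a <-]; exists a.+1 => //; rewrite iterSr. Qed.

(** * Phases of a run *)

Definition tape_at (l : seq cell) (w : seq symbol) : stape :=
  Tape l (head None (map sym w)) (behead (map sym w)).

(* The left part is given reversed; the blank at its far end is the sentinel
   that stops rewinding. *)
Definition cursor (s r : seq symbol) : stape := tape_at (rcons (map sym s) None) r.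

(** The head stands on the sentinel. *)
Definition before (w : seq symbol) : stape := Tape [::] None (map sym w).

(** * Binary numerals *)

Definition value (s : seq bool) : nat := foldr (fun (b : bool) v => b + v.*2) 0 s.

Definition digits (n : nat) : seq bool :=
  mkseq (fun i => odd (n %/ 2 ^ i)) (trunc_log 2 n).+1.

Lemma binaryE n : binary n = map Bit (digits n).
Proof. by rewrite /binary /digits /mkseq -map_comp. Qed.

(** By induction on [k], splitting off the lowest digit, the first [k] digits of [m] represent
    [m %% 2 ^ k]; [trunc_log] supplies enough digits for the residue to be the number. *)
Lemma value_digits n : value (digits n) = n.
Proof.
have H k m : value (mkseq (fun i => odd (m %/ 2 ^ i)) k) = m %% 2 ^ k.
  elim: k m => [|k IH] m; first by rewrite modn1.
  have -> : mkseq (fun i => odd (m %/ 2 ^ i)) k.+1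
            = odd m :: mkseq (fun i => odd (m./2 %/ 2 ^ i)) k.
    rewrite /mkseq /= divn1 (iotaDl 1 0) -map_comp; congr cons.
    by apply: eq_map => i /=; rewrite -divn2 -divnMA -expnS.
  have Em : m = m./2 %/ 2 ^ k * 2 ^ k.+1 + (odd m + (m./2 %% 2 ^ k).*2).
    rewrite -{1}(odd_double_half m) {1}(divn_eq m./2 (2 ^ k)) expnS.
    by move: (m./2 %/ 2 ^ k) (m./2 %% 2 ^ k) (2 ^ k) => a b d; lia.
  rewrite /= IH [in RHS]Em modnMDl [RHS]modn_small // expnS.
  have : m./2 %% 2 ^ k < 2 ^ k by rewrite ltn_pmod // expn_gt0.
  by move: (odd m) (m./2 %% 2 ^ k) (2 ^ k) => b r p; lia.
by rewrite /digits H modn_small // trunc_log_ltn.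
Qed.

(* The second parameter is the distance from the head to the sentinel. *)
Inductive rewinding (w : seq symbol) : nat -> stape -> Prop :=
  | Rewound : rewinding w 0 (before w)
  | Rewinding s x r : catrev s (x :: r) = w ->
      rewinding w (size s).+1 (cursor s (x :: r)).

Lemma rewinding_scanned w d t : rewinding w d t -> isSome (scanned t) = (0 < d).
Proof. by case. Qed.

(** A head that has reached the sentinel waits there ([0.-1 = 0]), so three heads at different
    distances can rewind together. *)
Lemma rewinding_act w d t : rewinding w d t ->
  rewinding w d.-1
    (act (if isSome (scanned t) then (scanned t, Left) else (scanned t, Stay)) t).
Proof.
case=> [|[|y s] x r <-] /=; [exact: Rewound | exact: Rewound | ].
exact: (@Rewinding _ s y (x :: r)).
Qed.

Lemma left_cells_iter_move k t :
  left_cells (iter k (@move (symbol + void) Left) t) = drop k (left_cells t).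
Proof.
elim: k => [|k IH]; first by rewrite drop0.
rewrite iterS -add1n -drop_drop drop1 -IH.
by case: (iter k _ t).
Qed.

(** After at most [n] steps all three heads are on their sentinels; one more step leaves them and
    charges [a], and a last one charges [b]. *)
Lemma rewind_run n i c a b w1 w2 w3 d1 d2 d3 t u v :
  rewinding w1 d1 t -> rewinding w2 d2 u -> rewinding w3 d3 v ->
  d1 <= n -> d2 <= n -> d3 <= n ->
  reach n.+2 (PConf (Rewind a b) i t u v c)
    (PConf First i (cursor [::] w1) (cursor [::] w2) (cursor [::] w3)
      (iter (a + b) (@move _ Left) c)).
Proof.
elim: n d1 d2 d3 t u v => [|n IH] d1 d2 d3 t u v rt ru rv le1 le2 le3.
  case: rt le1 => // _; case: ru le2 => // _; case: rv le3 => // _.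
  by exists 2 => //; case: i c a b => [il ia ir] [cl ca cr] [] [].
case: (posnP (d1 + d2 + d3)) => [d0|d_gt0].
  have [d10 d20 d30] : [/\ d1 = 0, d2 = 0 & d3 = 0] by split; lia.
  move: d10 d20 d30 rt ru rv => -> -> -> rt ru rv.
  by apply: (@reach_leq n.+2) => //; apply: IH rt ru rv _ _ _.
apply: reach_step; rewrite /pstep /=.
rewrite (rewinding_scanned rt) (rewinding_scanned ru) (rewinding_scanned rv).
have -> : [|| 0 < d1, 0 < d2 | 0 < d3] by lia.
have -> : act (scanned i, Stay) i = i by case: (i).
have -> : act (scanned c, Stay) c = c by case: (c).
have := IH _ _ _ _ _ _ (rewinding_act rt) (rewinding_act ru) (rewinding_act rv).
rewrite (rewinding_scanned rt) (rewinding_scanned ru) (rewinding_scanned rv).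
by apply; lia.
Qed.

(** * Digitwise addition and comparison *)

Lemma value_head s : value s = head false s + (value (behead s)).*2.
Proof. by case: s. Qed.

(** The flag [g] on the right-hand side makes the strict comparison non-strict, that is, it decides
    ties. The lowest digits only affect how a tie of the higher ones is decided. *)
Lemma ltn_digit (z x g : bool) (Z X : nat) :
  (z + Z.*2 < x + X.*2 + g) = (Z < X + ge_update g x z).
Proof. by move: z x g => [] [] []; rewrite /ge_update /=; lia. Qed.

(** The same with a full adder on the right: the exclusive or is the digit of the sum, [majority]
    the outgoing carry. *)
Lemma ltn_add_digit (z x y k g : bool) (Z X Y : nat) :
  (z + Z.*2 < x + X.*2 + (y + Y.*2) + k + g) =
  (Z < X + Y + majority x y k + ge_update g (x (+) y (+) k) z).
Proof. by move: z x y k g => [] [] [] [] []; rewrite /ge_update /=; lia. Qed.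

(* [k] is the carry of the addition, and the other flags are the outcomes of
   the comparisons of the digits already read. *)
Lemma compare_run n k g g1 g2 i c X Y Z s1 s2 s3 r1 r2 r3 :
  size X <= n -> size Y <= n -> size Z <= n ->
  reach n.+1
    (PConf (Compare k g g1 g2) i (cursor s3 (map Bit Z ++ EndSection :: r3))
      (cursor s1 (map Bit X ++ EndNumber :: r1))
      (cursor s2 (map Bit Y ++ EndNumber :: r2)) c)
    (PConf (RowEnd (value Z < value X + value Y + k + g)
                   ((value Z < value X + g1) && (value Z < value Y + g2))) i
      (cursor (catrev (map Bit Z) s3) (EndSection :: r3))
      (cursor (catrev (map Bit X) s1) (EndNumber :: r1))
      (cursor (catrev (map Bit Y) s2) (EndNumber :: r2)) c).
Proof.
case: i c => [il ia ir] [cl ca cr].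
elim: n k g g1 g2 X Y Z s1 s2 s3 => [|n IH] k g g1 g2 X Y Z s1 s2 s3 sX sY sZ.
  case: X Y Z sX sY sZ => [|//] [|//] [|//] _ _ _.
  by exists 1 => //; case: k g g1 g2 => [] [] [] [].
have [/and3P[/nilP-> /nilP-> /nilP->]|nonnil] := boolP [&& nilp X, nilp Y & nilp Z].
  by exists 1 => //; case: k g g1 g2 => [] [] [] [].
apply: reach_step.
rewrite (value_head X) (value_head Y) (value_head Z) ltn_add_digit !ltn_digit.
(* The numbers may differ in length: on an exhausted one the head stays on the terminator, which
   counts as the digit 0, matching [head false] and the empty [take 1]. *)
have := IH (majority (head false X) (head false Y) k)
  (ge_update g (head false X (+) head false Y (+) k) (head false Z))
  (ge_update g1 (head false X) (head false Z))
  (ge_update g2 (head false Y) (head false Z))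
  (behead X) (behead Y) (behead Z)
  (catrev (map Bit (take 1 X)) s1) (catrev (map Bit (take 1 Y)) s2)
  (catrev (map Bit (take 1 Z)) s3).
have le_pred j : j <= n.+1 -> j.-1 <= n by lia.
rewrite !size_behead => /(_ (le_pred _ sX) (le_pred _ sY) (le_pred _ sZ)).
by case: X Y Z nonnil {sX sY sZ} => [|x X] [|y Y] [|z Z] //= _;
  rewrite /pstep /= ?take0.
Qed.

(** * Reading the target and the utility table *)

Definition in_row (s : symbol) : bool :=
  match s with Bit _ | EndNumber => true | _ => false end.

Definition pass (l : seq cell) (w : seq symbol) : seq cell := catrev (map sym w) l.

(** The head stands on the blank just right of the last mark. *)
Definition marks (k : nat) : stape := tape_at (nseq k (sym EndRow)) [::].

Lemma copy_target D l w s u v c :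
  reach (size D).+1
    (PConf CopyTarget (tape_at l (map Bit D ++ EndSection :: w)) (cursor s [::]) u v c)
    (PConf CopyRow (tape_at (pass l (rcons (map Bit D) EndSection)) w)
      (cursor (catrev (map Bit D) s) [:: EndSection]) u v c).
Proof.
case: u v c => [ul ua ur] [vl va vr] [cl ca cr].
elim: D l s => [|d D IH] l s /=; first by exists 1.
by apply: reach_step; exact: (IH (sym _ :: l) (_ :: s)).
Qed.

(** Only the first agent's row is copied, since uniform utilities make all rows equal; the later
    rows are merely counted. Of the two marks per agent, one is written on reading [EndRow], the
    other in phase [Mark]. *)
Lemma copy_row W l w s t c : all in_row W ->
  reach (size W).+2
    (PConf CopyRow (tape_at l (W ++ EndRow :: w)) t (cursor s [::]) (cursor s [::])
      (marks c))
    (PConf Skim (tape_at (pass l (rcons W EndRow)) w) t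
      (cursor (catrev W s) [:: EndRow]) (cursor (catrev W s) [:: EndRow])
      (marks c.+2)).
Proof.
case: t => [tl ta tr].
elim: W l s => [|[b| | |] W IH] //= l s; first by exists 2.
all: by move=> // allW; apply: reach_step; exact: (IH (sym _ :: l) (_ :: s)).
Qed.

Lemma skim_row W l w t u v c : all in_row W ->
  reach (size W).+2
    (PConf Skim (tape_at l (W ++ EndRow :: w)) t u v (marks c))
    (PConf Skim (tape_at (pass l (rcons W EndRow)) w) t u v (marks c.+2)).
Proof.
case: t u v => [tl ta tr] [ul ua ur] [vl va vr].
elim: W l => [|[b| | |] W IH] //= l; first by exists 2.
all: by move=> // allW; apply: reach_step; exact: (IH (sym _ :: l)).
Qed.

Lemma pass_cat l w w' : pass (pass l w) w' = pass l (w ++ w').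
Proof. by rewrite /pass map_cat !catrevE rev_cat catA. Qed.

Lemma catrev_catrev (T : Type) (s w w' : seq T) :
  catrev w' (catrev w s) = catrev (w ++ w') s.
Proof. by rewrite !catrevE rev_cat catA. Qed.

Lemma catrev_cursor (s w r : seq symbol) : catrev (catrev w s) r = catrev s (w ++ r).
Proof. by rewrite !catrevE rev_cat revK catA. Qed.

Lemma size_catrev (s w : seq symbol) : size (catrev w s) = size w + size s.
Proof. by rewrite catrevE size_cat size_rev. Qed.

Lemma rewinding_end W x :
  rewinding (rcons W x) (size W).+1 (cursor (catrev W [::]) [:: x]).
Proof.
have := @Rewinding (rcons W x) (catrev W [::]) x [::].
by rewrite catrev_cursor cats1 size_catrev addn0; apply.
Qed.

Definition row_table (Rs : seq (seq symbol)) : seq symbol :=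
  flatten [seq rcons R EndRow | R <- Rs].

Lemma row_table_cons R Rs : row_table (R :: Rs) = rcons R EndRow ++ row_table Rs.
Proof. by []. Qed.

(** Serves to bound the number of jobs by the length of the encoding. *)
Lemma size_row_table Rs : size Rs <= size (row_table Rs).
Proof.
elim: Rs => // R Rs IH; rewrite row_table_cons.
by rewrite size_cat size_rcons addSn ltnS (leq_trans IH) ?leq_addl.
Qed.

Lemma skim_rows (Ws : seq (seq symbol)) l w t u v c : all (all in_row) Ws ->
  reach (2 * size (row_table Ws))
    (PConf Skim (tape_at l (row_table Ws ++ w)) t u v
      (marks c))
    (PConf Skim (tape_at (pass l (row_table Ws)) w) t u v
      (marks (c + (size Ws).*2))).
Proof.
elim: Ws l c => [|W Ws IH] l c; first by rewrite addn0; exists 0.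
move=> /andP[allW allWs]; rewrite row_table_cons -catA (cat_rcons _ _ (_ ++ w)) -pass_cat.
have -> : c + (size (W :: Ws)).*2 = c.+2 + (size Ws).*2 by rewrite /=; lia.
apply: reach_leq _ (reach_trans (skim_row _ _ _ _ _ _ allW) (IH _ _ allWs)).
by rewrite size_cat size_rcons; lia.
Qed.

Lemma skip_both D i t s r c :
  reach (size D).+1
    (PConf SkipBoth i t (cursor s (map Bit D ++ EndNumber :: r))
      (cursor s (map Bit D ++ EndNumber :: r)) c)
    (PConf First i t (cursor (catrev (rcons (map Bit D) EndNumber) s) r)
      (cursor (catrev (rcons (map Bit D) EndNumber) s) r) c).
Proof.
case: i t c => [il ia ir] [tl ta tr] [cl ca cr].
elim: D s => [|d D IH] s /=; first by exists 1.
by apply: reach_step; exact: (IH (_ :: s)).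
Qed.

Lemma skip_one D i t u s r c :
  reach (size D).+1
    (PConf SkipOne i t u (cursor s (map Bit D ++ EndNumber :: r)) c)
    (PConf Second i t u (cursor (catrev (rcons (map Bit D) EndNumber) s) r) c).
Proof.
case: i t u c => [il ia ir] [tl ta tr] [ul ua ur] [cl ca cr].
elim: D s => [|d D IH] s /=; first by exists 1.
by apply: reach_step; exact: (IH (_ :: s)).
Qed.

(** * One row of the adjacency matrix *)

Section Row.
Variables (T : Type) (e : T -> bool) (f : T -> nat).

Definition numbers (A : seq T) : seq symbol :=
  flatten [seq rcons (binary (f x)) EndNumber | x <- A].

Definition bits (A : seq T) : seq symbol := [seq Bit (e x) | x <- A].


Lemma numbers_cons x A : numbers (x :: A) = rcons (binary (f x)) EndNumber ++ numbers A.
Proof. by []. Qed.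

(** Each one read in the matrix row moves both utility heads past one number, which keeps them
    aligned with the scan. *)
Lemma first_ones A l w t s r c : all e A ->
  reach (size A + size (numbers A))
    (PConf First (tape_at l (bits A ++ w)) t (cursor s (numbers A ++ r))
      (cursor s (numbers A ++ r)) c)
    (PConf First (tape_at (pass l (bits A)) w) t (cursor (catrev (numbers A) s) r)
      (cursor (catrev (numbers A) s) r) c).
Proof.
case: t c => [tl ta tr] [cl ca cr].
elim: A l s => [|x A IH] l s; first by exists 0.
move=> /andP[ex allA].
rewrite numbers_cons -catrev_catrev binaryE -catA (cat_rcons _ _ (_ ++ r)).
apply: (@reach_leq (1 + ((size (digits (f x))).+1 + (size A + size (numbers A))))).
  by rewrite size_cat size_rcons size_map /=; lia.
have := IH (sym (Bit true) :: l)
  (catrev (rcons (map Bit (digits (f x))) EndNumber) s) allA.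
move/(reach_trans (skip_both _ _ _ _ _ _)) => R.
by apply: reach_step; rewrite /pstep /= ex; apply: R.
Qed.

Lemma second_ones A l w t u s r c : all e A ->
  reach (size A + size (numbers A))
    (PConf Second (tape_at l (bits A ++ w)) t u (cursor s (numbers A ++ r)) c)
    (PConf Second (tape_at (pass l (bits A)) w) t u (cursor (catrev (numbers A) s) r) c).
Proof.
case: t u c => [tl ta tr] [ul ua ur] [cl ca cr].
elim: A l s => [|x A IH] l s; first by exists 0.
move=> /andP[ex allA].
rewrite numbers_cons -catrev_catrev binaryE -catA (cat_rcons _ _ (_ ++ r)).
apply: (@reach_leq (1 + ((size (digits (f x))).+1 + (size A + size (numbers A))))).
  by rewrite size_cat size_rcons size_map /=; lia.
have := IH (sym (Bit true) :: l)
  (catrev (rcons (map Bit (digits (f x))) EndNumber) s) allA.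
move/(reach_trans (skip_one _ _ _ _ _ _ _)) => R.
by apply: reach_step; rewrite /pstep /= ex; apply: R.
Qed.

Lemma row_end A l w a b t u v c :
  reach (size A).+1
    (PConf (RowEnd a b) (tape_at l (bits A ++ EndRow :: w)) t u v c)
    (PConf (Rewind a b) (tape_at (pass l (rcons (bits A) EndRow)) w) t u v c).
Proof.
case: t u v c => [tl ta tr] [ul ua ur] [vl va vr] [cl ca cr].
elim: A l => [|x A IH] l; first by exists 1.
by apply: reach_step; exact: (IH (sym _ :: l)).
Qed.

Lemma two_zeros E p q : [seq x <- E | ~~ e x] = [:: p; q] ->
  exists A B C, [/\ E = A ++ p :: B ++ q :: C, all e A, all e B & ~~ e p && ~~ e q].
Proof.
have split_first (F : seq T) x r : [seq x <- F | ~~ e x] = x :: r ->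
    exists A B, [/\ F = A ++ x :: B, all e A, ~~ e x & [seq x <- B | ~~ e x] = r].
  elim: F => //= y F IH; case: ifPn => [ey [<- <-]|].
    by exists [::], F; split.
  move=> /negbNE ey /IH[A [B [-> allA ex defr]]].
  by exists (y :: A), B; split; rewrite /= ?ey.
move=> /split_first[A [F [-> allA ep]]] /split_first[B [C [-> allB eq _]]].
by exists A, B, C; rewrite ep eq.
Qed.

Lemma size_numbers A : size A <= size (numbers A).
Proof.
elim: A => // x A IH; rewrite numbers_cons size_cat size_rcons addSn ltnS.
exact: leq_trans IH (leq_addl _ _).
Qed.

Lemma row_run E p q l w eta c n :
  [seq x <- E | ~~ e x] = [:: p; q] ->
  size (digits eta) <= n -> size (numbers E) <= n ->
  reach (4 * n + 10)
    (PConf First (tape_at l (rcons (bits E) EndRow ++ w))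
      (cursor [::] (rcons (binary eta) EndSection))
      (cursor [::] (rcons (numbers E) EndRow))
      (cursor [::] (rcons (numbers E) EndRow)) c)
    (PConf First (tape_at (pass l (rcons (bits E) EndRow)) w)
      (cursor [::] (rcons (binary eta) EndSection))
      (cursor [::] (rcons (numbers E) EndRow))
      (cursor [::] (rcons (numbers E) EndRow))
      (iter ((eta <= f p + f q) + ((eta <= f p) && (eta <= f q)))
            (@move _ Left) c)).
Proof.
case: c => [cl ca cr].
move=> /two_zeros[A [B [C [-> allA allB /andP[ep eq]]]]] le_eta.
have catN F G : numbers (F ++ G) = numbers F ++ numbers G.
  by rewrite /numbers map_cat flatten_cat.
have -> : rcons (numbers (A ++ p :: B ++ q :: C)) EndRow =
    numbers A ++ map Bit (digits (f p)) ++ EndNumber :: numbers B ++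
    map Bit (digits (f q)) ++ EndNumber :: numbers C ++ [:: EndRow].
  by rewrite !(catN, numbers_cons) -cats1 -!cats1 !binaryE -!catA.
have -> : rcons (bits (A ++ p :: B ++ q :: C)) EndRow =
    bits A ++ [:: Bit false] ++ bits B ++ [:: Bit false] ++ rcons (bits C) EndRow.
  rewrite /bits map_cat /= map_cat /= (negbTE ep) (negbTE eq) -cats1 -!cats1.
  by rewrite -!catA /= -!catA.
rewrite binaryE -[rcons (map Bit _) _]cats1 -!pass_cat -!catA.
rewrite !(catN, numbers_cons, size_cat, size_rcons, binaryE, size_map Bit) => le_n.
set wU := numbers A ++ _.
have szA := size_numbers A; have szB := size_numbers B; have szC := size_numbers C.
(* The summands are the times of the successive phases; the two outer [.+1] are the steps that read
   the zeros of [p] and [q]. *)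
apply: (@reach_leq ((size A + size (numbers A)) + (((size (digits (f p))).+1 +
  ((size B + size (numbers B)) + (n.+1 + ((size C).+1 + n.+3)).+1))).+1)).
  lia.
apply: reach_trans (first_ones _ _ _ _ _ _ allA) _.
pose s1 := catrev (numbers A) [::].
pose s2 := catrev (rcons (map Bit (digits (f p))) EndNumber) s1.
pose r2 := numbers B ++ map Bit (digits (f q)) ++ EndNumber :: numbers C ++ [:: EndRow].
pose r1 := map Bit (digits (f p)) ++ EndNumber :: r2.
pose wT := map Bit (digits eta) ++ [:: EndSection].
pose l1 := sym (Bit false) :: pass l (bits A).
pose l2 := sym (Bit false) :: pass l1 (bits B).
apply: reach_step.
(* The first head stays on the number of [p], while the second goes on to that of [q]. *)
apply: (reach_trans (skip_one (digits (f p)) (tape_at l1 _) (cursor [::] wT)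
  (cursor s1 r1) s1 r2 (Tape cl ca cr))).
apply: (reach_trans (second_ones l1 _ (cursor [::] wT) (cursor s1 r1) s2 _
  (Tape cl ca cr) allB)).
apply: reach_step.
have le_n3 : size (digits (f p)) <= n /\ size (digits (f q)) <= n by lia.
(* Initially there is no carry, and the flags are [true] because equality counts as reaching the
   target. *)
apply: (reach_trans (@compare_run n false true true true (tape_at l2 _) (Tape cl ca cr)
  (digits (f p)) (digits (f q)) (digits eta) s1 (catrev (numbers B) s2) [::] r2
  (numbers C ++ [:: EndRow]) [::] le_n3.1 le_n3.2 le_eta)).
rewrite !value_digits !addn0 !addn1 !ltnS (cat_rcons _ _ w).
apply: reach_trans (row_end C _ _ _ _ _ _ _ _) _.
have rT := rewinding_end (map Bit (digits eta)) EndSection.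
rewrite -cats1 in rT.
have r1U : catrev (catrev (map Bit (digits (f p))) s1) (EndNumber :: r2) = wU.
  by rewrite !catrev_cursor.
have r2U : catrev (catrev (map Bit (digits (f q))) (catrev (numbers B) s2))
    (EndNumber :: numbers C ++ [:: EndRow]) = wU.
  by rewrite !catrev_cursor cat_rcons.
apply: rewind_run rT (Rewinding r1U) (Rewinding r2U) _ _ _;
  rewrite /s2 /s1 ?(size_catrev, size_rcons, size_map Bit) ?addn0; lia.
Qed.

End Row.

(** * The complete run *)

Section Decision.
Variables (T : finType) (e : rel T) (f : T -> nat) (eta : nat).

Definition zeros (x : T) : {set T} := [set y | ~~ e x y].

(* The largest number of agents that a pair of non-adjacent jobs can serve:
   2 if each job suffices alone, else 1 if both together do, else 0. *)
Definition capacity (x : T) : nat :=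
  (eta <= \sum_(z in zeros x) f z) + [forall (z | z \in zeros x), eta <= f z].

Lemma rows_run (X : seq T) l w c n :
  (forall x, #|zeros x| = 2) ->
  size (digits eta) <= n -> size (numbers f (enum T)) <= n ->
  reach (size X * (4 * n + 10))
    (PConf First (tape_at l (row_table [seq bits (e x) (enum T) | x <- X] ++ w))
      (cursor [::] (rcons (binary eta) EndSection))
      (cursor [::] (rcons (numbers f (enum T)) EndRow))
      (cursor [::] (rcons (numbers f (enum T)) EndRow)) c)
    (PConf First (tape_at (pass l (row_table [seq bits (e x) (enum T) | x <- X])) w)
      (cursor [::] (rcons (binary eta) EndSection))
      (cursor [::] (rcons (numbers f (enum T)) EndRow))
      (cursor [::] (rcons (numbers f (enum T)) EndRow))
      (iter (\sum_(x <- X) capacity x) (@move _ Left) c)).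
Proof.
move=> card2 le_eta le_N; elim: X l c => [|x X IH] l c.
  by rewrite big_nil; exists 0.
have [p [q Epq]] : exists p q, enum (zeros x) = [:: p; q].
  have := card2 x; rewrite cardE.
  by case: (enum _) => [|p [|q []]] // _; exists p, q.
have Ef : [seq y <- enum T | ~~ e x y] = [:: p; q].
  by rewrite -Epq enumT /enum_mem; apply: eq_filter => y; rewrite /= inE.
have -> : \sum_(x <- x :: X) capacity x = \sum_(x <- X) capacity x +
    ((eta <= f p + f q) + ((eta <= f p) && (eta <= f q))).
  rewrite big_cons addnC; congr (_ + (_ + _)).
    by rewrite -big_enum Epq /= !big_cons big_nil addn0.
  congr nat_of_bool; have mem z : (z \in zeros x) = (z \in [:: p; q]).
    by rewrite -Epq mem_enum.
  apply/forall_inP/andP => [H|[Hp Hq] z].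
    by split; apply: H; rewrite mem !inE eqxx ?orbT.
  by rewrite mem !inE => /orP[] /eqP->.
rewrite iterD map_cons row_table_cons -catA -pass_cat mulSn.
exact: (reach_trans (row_run _ _ _ Ef le_eta le_N) (IH _ _)).
Qed.

Lemma all_in_row_numbers (g : T -> nat) X : all in_row (numbers g X).
Proof.
elim: X => // x X IH; rewrite numbers_cons all_cat IH andbT all_rcons binaryE.
by rewrite all_map; apply/allP.
Qed.

Definition start_conf (w : seq symbol) : pconf :=
  PConf Init (tape_at [::] w) (blank_tape _) (blank_tape _) (blank_tape _)
    (blank_tape _).

Definition halts_within (t : nat) (w : seq symbol) (b : bool) : Prop :=
  exists2 p, reach t (start_conf w) p & phase_verdict (pphase p) = Some b.

(** Without agents the utility table is empty: the second [EndSection] follows at once, and the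
    machine accepts. *)
Lemma run_no_agent w :
  halts_within (size (digits eta)).+3 (binary eta ++ [:: EndSection, EndSection & w]) true.
Proof.
eexists.
  apply: reach_step; rewrite binaryE -addn1.
  apply: (reach_trans (copy_target (digits eta) [::] (EndSection :: w) [::]
    (cursor [::] [::]) (cursor [::] [::]) (blank_tape _))).
  exact/reach_step/reach_refl.
by [].
Qed.

(** [Rs] holds the utility rows after the first, so the counter gets [2 * (size Rs).+1] marks. The
    bound is quadratic because each of at most [N] matrix rows takes time linear in [N]. *)
Lemma run_agents Rs w :
  (forall x, #|zeros x| = 2) -> all (all in_row) Rs ->
  w = binary eta ++ EndSection :: row_table (numbers f (enum T) :: Rs) ++
      EndSection :: row_table [seq bits (e x) (enum T) | x <- enum T] ->
  halts_within (4 * size w ^ 2 + 20 * size w + 20) w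
    (2 * (size Rs).+1 <= \sum_x capacity x).
Proof.
move=> card2 inR defw; set N := size w.
have : N = size (digits eta) + (size (numbers f (enum T)) + (size (row_table Rs) +
     size (row_table [seq bits (e x) (enum T) | x <- enum T])).+2).+1.
  rewrite /N defw row_table_cons binaryE.
  by rewrite !(size_cat, size_rcons, size_map Bit) /= !size_cat size_rcons /=; lia.
have := size_row_table [seq bits (e x) (enum T) | x <- enum T].
rewrite size_map; set m := size (enum T) => le_m defN.
set nE := numbers f (enum T) in defN defw *.
set mT := row_table _ in le_m defN defw *.
pose wT := rcons (map Bit (digits eta)) EndSection.
pose k := 2 * (size Rs).+1.
pose S := \sum_(x <- enum T) capacity x.
pose c := iter S (@move _ Left) (marks k).
(* From the blank right of the marks, [S + 1] moves to the left end on a mark iff [S < k]. *)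
have scan_c : isSome (scanned (move Left c)) = (S < k).
  have -> : scanned (move Left c) = head None (left_cells c) by case: (c).
  by rewrite left_cells_iter_move drop_nseq -subn_gt0; case: (k - S).
have defk : 2 + (size Rs).*2 = k by rewrite /k; lia.
(* The last two steps: at the end of the matrix the counter head moves left once more, and [Final]
   inspects the cell. *)
have out t u b c' i : scanned i = None -> isSome (scanned (move Left c')) = b ->
    exists2 p, reach 2 (PConf First i (cursor [::] t) (cursor [::] u) (cursor [::] u) c') p
      & phase_verdict (pphase p) = Some (~~ b).
  move=> i0 <-; eexists; first by exists 2.
  by case: i i0 c' => [il ia ir] /= -> [[|[a|] cl] ca cr].
have R1 := copy_target (digits eta) [::] (row_table (nE :: Rs) ++ EndSection :: mT)
  [::] (cursor [::] [::]) (cursor [::] [::]) (marks 0).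
set l1 := pass _ _ in R1.
have R2 := copy_row l1 (row_table Rs ++ EndSection :: mT) [::]
  (cursor (catrev (map Bit (digits eta)) [::]) [:: EndSection]) 0
  (all_in_row_numbers f (enum T)).
set l2 := pass _ _ in R2.
have R3 := skim_rows l2 (EndSection :: mT)
  (cursor (catrev (map Bit (digits eta)) [::]) [:: EndSection])
  (cursor (catrev nE [::]) [:: EndRow]) (cursor (catrev nE [::]) [:: EndRow]) 2 inR.
set l3 := pass _ _ in R3.
have rT : rewinding wT _ _ := rewinding_end (map Bit (digits eta)) EndSection.
have rU := rewinding_end nE EndRow.
have R4 := @rewind_run N.+1 (tape_at (sym EndSection :: l3) mT) (marks k) false false _ _ _
  _ _ _ _ _ _ rT rU rU.
have R5 := rows_run (enum T) (sym EndSection :: l3) [::] (marks k) card2.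
set l4 := pass _ _ in R5.
have [p R6 vp] := out wT (rcons nE EndRow) _ c (tape_at l4 [::]) erefl scan_c.
exists p; last by rewrite vp -leqNgt -big_enum.
rewrite row_table_cons -catA (cat_rcons _ _ (_ ++ _)) in R1.
rewrite defk in R3 R4; rewrite cats0 binaryE in R5.
have szD : size (digits eta) <= N by lia.
have szE : size nE <= N by lia.
have szD' : size (map Bit (digits eta)) < N.+1 by rewrite size_map ltnS.
apply: (@reach_leq ((size (digits eta)).+1 + ((size nE).+2 + (2 * size (row_table Rs) +
    (N.+3 + (m * (4 * N + 10) + 2)).+1))).+1).
  have : m * (4 * N + 10) <= N * (4 * N + 10) by rewrite leq_mul2r; apply/orP; right; lia.
  by rewrite expnS expn1; lia.
rewrite defw binaryE row_table_cons -catA (cat_rcons _ _ (_ ++ _)).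
apply: reach_step; apply: (reach_trans R1); apply: (reach_trans R2).
apply: (reach_trans R3); apply: reach_step.
exact: (reach_trans (R4 szD' szE szE) (reach_trans (R5 N szD szE) R6)).
Qed.

End Decision.

(** * Feasibility and capacities *)

Section Feasibility.
Variables (T : finType) (e : rel T) (f : T -> nat) (eta : nat).
Hypotheses (e_sym : symmetric e) (e_irr : irreflexive e) (eta_gt0 : 0 < eta).
Hypothesis card2 : forall x, #|zeros e x| = 2.

Let mem_zeros_id x : x \in zeros e x. Proof. by rewrite inE e_irr. Qed.

(** For distinct [x] and [y], both sets contain both jobs and have only two elements. Hence the sets
    [zeros] partition the jobs into pairs. *)
Lemma zeros_eq x y : y \in zeros e x -> zeros e y = zeros e x.
Proof.
have [->|ne_xy] := eqVneq x y => // y_x.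
have Z z : x \in zeros e z -> y \in zeros e z -> zeros e z = [set x; y].
  move=> xz yz; apply/esym/eqP; rewrite eqEcard card2 cards2 ne_xy andbT.
  by apply/subsetP => t /set2P[]->.
have x_y : x \in zeros e y by rewrite inE e_sym; rewrite inE in y_x.
exact: etrans (Z y x_y (mem_zeros_id y)) (esym (Z x (mem_zeros_id x) y_x)).
Qed.

Definition double (x : T) : bool := [forall (z | z \in zeros e x), eta <= f z].

Definition good (x : T) : bool := eta <= \sum_(z in zeros e x) f z.

Lemma double_good x : double x -> good x.
Proof.
move=> /forall_inP/(_ x (mem_zeros_id x)) le_x; rewrite /good (bigD1 x) //=.
by rewrite (leq_trans le_x) ?leq_addr.
Qed.

Variable A : finType.

Definition allocation (phi : A -> {set T}) : Prop :=
  [/\ forall a, independent e (phi a),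
      forall a, eta <= \sum_(x in phi a) f x &
      forall a b, a != b -> [disjoint phi a & phi b]].

(** Double counting of the agents [a] and jobs [x] with [phi a] inside the pair of [x]: each agent
    occurs for both jobs of a pair, and each job for at most [capacity x] agents. *)
Lemma allocation_capacity phi :
  allocation phi -> 2 * #|A| <= \sum_x capacity e f eta x.
Proof.
move=> [indep large disj].
have phi_neq0 a : exists z, z \in phi a.
  apply/set0Pn; apply: contraTneq (large a) => ->.
  by rewrite big_set0 -ltnNge.
have sub_zeros a z : z \in phi a -> phi a \subset zeros e z.
  by move=> za; apply/subsetP => y ya; rewrite inE (indep a).
have -> : 2 * #|A| = \sum_(a : A) 2 by rewrite sum_nat_const mulnC.
apply: (@leq_trans (\sum_(a : A) \sum_x (phi a \subset zeros e x))).
  apply: leq_sum => a _; have [z za] := phi_neq0 a.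
  rewrite -(card2 z) -sum1_card [X in _ <= X](bigID (mem (zeros e z))) /=.
  rewrite -[X in X <= _]addn0 leq_add // leq_sum // => x xz.
  by rewrite (zeros_eq xz) sub_zeros.
rewrite exchange_big /=; apply: leq_sum => x _.
pose S := [set a | phi a \subset zeros e x].
have -> : \sum_a (phi a \subset zeros e x) = #|S|.
  by rewrite -sum1dep_card [RHS]big_mkcond; apply: eq_bigr => a _; case: ifP.
(* One job per agent, distinct by disjointness: at most two agents share a pair. *)
pose h a := xchoose (phi_neq0 a).
have hP a : h a \in phi a by exact: xchooseP.
have h_inj : injective h.
  move=> a b hab; apply/eqP; apply: contraT => /disj/pred0P/(_ (h a)) /=.
  by rewrite hP hab hP.
have hS : h @: S \subset zeros e x.
  by apply/subsetP => _ /imsetP[a aS ->]; rewrite inE in aS; apply: (subsetP aS).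
have cardS : #|S| <= 2 by rewrite -(card_imset _ h_inj) -(card2 x) subset_leq_card.
have [S0|[a aS]] := set_0Vmem S; first by rewrite S0 cards0.
have -> : capacity e f eta x = 1 + double x.
  congr (_ + _); apply/eqP; rewrite eqb1; apply: leq_trans (large a) _.
  rewrite [X in _ <= X](big_setID (phi a)) /=.
  by rewrite inE in aS; rewrite (setIidPr aS) leq_addr.
have [ltS|geS] := ltnP #|S| 2; first by apply: leq_trans (leq_addr _ _); rewrite -ltnS.
suff -> : double x by [].
have hSE : h @: S = zeros e x.
  by apply/eqP; rewrite eqEcard hS card2 card_imset.
apply/forall_inP => z; rewrite -hSE => /imsetP[b bS ->].
have /card_gt0P[d] : 0 < #|S :\ b| by move: geS; rewrite (cardsD1 b) bS.
rewrite !inE => /andP[ne_db dS].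
(* The other agent [d] holds the other job of the pair, so [b] must reach the target with one
   job. *)
suff Eb : phi b = [set h b] by move: (large b); rewrite Eb big_set1.
rewrite inE in bS; apply/eqP; rewrite eq_sym eqEcard sub1set hP cards1 -ltnS.
rewrite -(card2 x) proper_card // properEneq bS andbT.
apply: contraNneq ne_db => Eb; apply: contraT => /disj/pred0P/(_ (h d)) /=.
by rewrite hP Eb -hSE imset_f // inE.
Qed.

(** The share of one agent: a single job if the pair serves two agents, otherwise the whole pair. *)
Definition bundle (x : T) : {set T} := if double x then [set x] else zeros e x.

Lemma bundle_self x : x \in bundle x.
Proof. by rewrite /bundle; case: ifP; rewrite ?set11 ?mem_zeros_id. Qed.

(** Consequently, bundles that meet coincide. *)
Lemma bundle_eq x z : z \in bundle x -> bundle z = bundle x.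
Proof.
rewrite {1}/bundle; case: ifP => [_ /set1P-> //|ndx /zeros_eq zx].
by rewrite /bundle /double zx -/(double x) ndx.
Qed.

Lemma bundle_independent x : independent e (bundle x).
Proof.
move=> y z; rewrite /bundle; case: ifP => _.
  by move=> /set1P-> /set1P->; rewrite e_irr.
by move=> /zeros_eq <-; rewrite inE.
Qed.

Lemma bundle_large x : good x -> eta <= \sum_(z in bundle x) f z.
Proof.
rewrite /bundle; case: ifP => // /forall_inP/(_ x (mem_zeros_id x)) + _.
by rewrite big_set1.
Qed.

(** Grouped by bundle, the capacities add up to at most 2: a bundle is one job of capacity at most 2
    or two jobs of capacity at most 1. *)
Lemma capacity_bundles :
  \sum_x capacity e f eta x <= 2 * #|[set bundle x | x in good]|.
Proof.
have capE x : capacity e f eta x = good x + double x by [].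
(* Jobs that are not good have capacity 0, by [double_good]. *)
have -> : \sum_x capacity e f eta x = \sum_(x | good x) capacity e f eta x.
  rewrite [RHS]big_mkcond; apply: eq_bigr => x _; rewrite capE.
  by case gx: (good x) => //; rewrite (contraFF (@double_good x) gx).
rewrite (partition_big bundle (mem [set bundle x | x in good])) /=; last first.
  by move=> x gx; apply: imset_f.
rewrite mulnC -sum_nat_const leq_sum // => _ /imsetP[y gy ->].
apply: (@leq_trans (\sum_(x in bundle y) capacity e f eta x)).
  rewrite big_mkcond [X in _ <= X]big_mkcond leq_sum // => x _.
  by case: ifP => // /andP[_ /eqP <-]; rewrite bundle_self.
case dy: (double y).
  by rewrite /bundle dy big_set1 capE; case: (good y) (double y) => [] [].
rewrite -(card2 y) -sum1_card {1}/bundle dy leq_sum // => x xy.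
by rewrite capE /double (zeros_eq xy) -/(double y) dy addn0; case: good.
Qed.

(** There are at least as many bundles of good jobs as agents; matching their enumerations gives the
    agents distinct, hence disjoint, bundles. *)
Lemma capacity_allocation :
  2 * #|A| <= \sum_x capacity e f eta x -> exists phi, allocation phi.
Proof.
move=> /leq_trans/(_ capacity_bundles); rewrite leq_pmul2l // => le_AD.
pose phi a := enum_val (widen_ord le_AD (enum_rank a)) : {set T}.
have phiP a : exists2 x, good x & phi a = bundle x.
  by have /imsetP[x gx] := enum_valP (widen_ord le_AD (enum_rank a)); exists x.
exists phi; split=> [a|a|a b].
- by have [x _ ->] := phiP a; apply: bundle_independent.
- by have [x gx ->] := phiP a; apply: bundle_large.
apply: contraR => /pred0Pn[z /= /andP[]].
have phi_inj : injective phi.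
  by move=> c d /enum_val_inj/(congr1 val)/= /val_inj/enum_rank_inj.
rewrite -(inj_eq phi_inj); have [x _ ->] := phiP a; have [y _ ->] := phiP b.
by move=> /bundle_eq <- /bundle_eq <-.
Qed.

End Feasibility.

(** * From runs to the decision problem *)

Lemma halts_answers t w b :
  halts_within t w b -> answers_within matching_machine w t b.
Proof.
move=> [p [j le_jt Ep] vp]; rewrite /answers_within.
have -> : init matching_machine w = conf_of (start_conf w).
  congr (_, _); apply/ffunP => i; rewrite !ffunE /=.
  case: i => [[|[|[|[|[|i]]]]] lt_i5] //=.
  by rewrite /tape_of_seq /tape_at; case: w {Ep} => //= x w; rewrite -map_comp.
rewrite iter_step_conf_of -(subnK le_jt) iterD Ep.
(* A halting configuration is fixed, so the run can be padded to exactly [t] steps. *)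
have pstep_p : pstep p = p by case: p vp {Ep} => q i s u v c /= ->.
by elim: (t - j) => //= k; rewrite -iterS iterSr pstep_p.
Qed.

Theorem theorem8 :
  exists M : machine symbol,
    decides_in_polytime M encode_cffa
      (fun I : cffa => regular_m_minus_2 I /\ uniform I) feasible.
Proof.
exists matching_machine, (Poly [:: 20; 20; 4]%N) => I [reg unif].
have -> n : ((Poly [:: 20; 20; 4]%N).[n])%R = 4 * n ^ 2 + 20 * n + 20.
  rewrite horner_Poly /=.
  change (((0 * n + 4) * n + 20) * n + 20 = 4 * n ^ 2 + 20 * n + 20).
  by rewrite expnS expn1; lia.
(* Degree [m - 2] leaves two jobs not adjacent to [x], one of which is [x] itself. *)
have card2 x : #|zeros (@conflict I) x| = 2.
  apply: (@addnI (degree (@conflict I) x)); rewrite reg -(cardC [set y | conflict x y]).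
  by congr (_ + _); apply: eq_card => y; rewrite !inE.
have encE : encode_cffa I = binary (target I) ++ EndSection ::
    row_table [seq numbers (utility a) (enum (jobs I)) | a <- enum (agents I)] ++
    EndSection :: row_table [seq bits (@conflict I x) (enum (jobs I)) | x <- enum (jobs I)].
  by rewrite /encode_cffa /row_table -!map_comp.
case EA: (enum (agents I)) => [|a0 As].
  have noA (a : agents I) : False by have := mem_enum (agents I) a; rewrite EA.
  (* Without agents every allocation condition holds vacuously. *)
  exists true; split; last by split=> // _; exists (fun=> set0); split=> a; case: (noA a).
  rewrite encE EA; apply: halts_answers.
  have [p hp vp] := run_no_agent (target I)
    (row_table [seq bits (@conflict I x) (enum (jobs I)) | x <- enum (jobs I)]).
  exists p => //; apply: reach_leq hp.
  by rewrite binaryE size_cat (size_map Bit); move: (_ ^ 2) => k; lia.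
have sumE a (X : {set jobs I}) : \sum_(x in X) utility a x = \sum_(x in X) utility a0 x.
  by apply: eq_bigr => x _; apply: unif.
have cardA : #|agents I| = (size As).+1 by rewrite cardE EA.
exists (2 * #|agents I| <= \sum_x capacity (@conflict I) (utility a0) (target I) x).
split.
  apply: halts_answers; rewrite cardA.
  rewrite -(size_map (fun a => numbers (utility a) (enum (jobs I)))).
  apply: run_agents => //; last by rewrite encE EA.
  by apply/allP => _ /mapP[a _ ->]; apply: all_in_row_numbers.
have e_sym := @conflict_sym I; have e_irr := @conflict_irr I.
split=> [le_cap|[phi [indep large disj]]].
  have [phi [indep large disj]] := capacity_allocation e_sym e_irr card2 le_cap.
  by exists phi; split=> // a; rewrite sumE.
apply: (allocation_capacity e_sym e_irr (target_gt0 I) card2 (phi := phi)).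
by split=> // a; rewrite -(sumE a).
Qed.
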